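(* There is a non-clairvoyant online algorithm for the polytope scheduling problem with group completion times (PSP-G) that is $O(\log g)$-competitive, where $g := \max_{S \in \mathcal{S}} |S|$ is the size of the largest group.
   Context: PSP-G: We are given a set $J$ of $n$ jobs, each job $j$ with a processing requirement $p_j \ge 0$; a family $\mathcal{S} \subseteq 2^J$ of groups, each group $S$ with a weight $w_S > 0$; and a matrix $B = (b_{d,j}) \in \mathbb{Q}_{\ge 0}^{D \times n}$ defining the downward-closed polytope $\mathcal{P} = \{ y \in \mathbb{R}^n_{\ge 0} : B y \le \mathbf{1}\}$. A schedule chooses at every time $t \ge 0$ a rate vector $y(t) \in \mathcal{P}$; $y_j(t)$ is the rate at which job $j$ is processed. The completion time of job $j$ is $C_j = \min\{ t' : \int_0^{t'} y_j(t)\,\mathrm{d}t \ge p_j\}$, the completion time of a group $S$ is $C_S = \max_{j \in S} C_j$, and the objective is to minimize $\sum_{S \in \mathcal{S}} w_S C_S$. In the non-clairvoyant online model, the algorithm knows $J$, $\mathcal{S}$, the weights and $B$, but does not know the processing requirements $p_j$; it learns that a job is finished only when it completes, and it must choose $y(t)$ at each time $t$ based only on the information available at time $t$, without revoking earlier decisions. An algorithm is $\alpha$-competitive if on every instance its objective value is at most $\alpha$ times the optimal objective value. *)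

(* Defs.v *)
From HB Require Import structures.
From mathcomp Require Import all_boot all_order all_algebra.
From mathcomp Require Import all_classical all_reals all_analysis.

Set Implicit Arguments.
Unset Strict Implicit.
Unset Printing Implicit Defensive.

Import Order.TTheory GRing.Theory Num.Theory.
Import numFieldNormedType.Exports.

Local Open Scope classical_set_scope.
Local Open Scope ring_scope.

Definition polytope (R : realType) (D n : nat) (B : 'M[rat]_(D, n)) :
    set 'cV[R]_n :=
  [set y : 'cV[R]_n | (forall j, 0 <= y j ord0) /\
    (forall d, (map_mx ratr B *m y) d ord0 <= 1)].
Arguments polytope R {D n} B _.

(* What a non-clairvoyant algorithm knows in advance: everything but the
   processing requirements.  A polytope is bounded by definition; this is not
   implied by the form of the constraints (B may have a zero column). *)
Record pspg (R : realType) := PSPG {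
  njobs : nat;
  nrows : nat;
  groups : {set {set 'I_njobs}};
  weight : {set 'I_njobs} -> R;
  weight_gt0 : forall S, S \in groups -> 0 < weight S;
  bmat : 'M[rat]_(nrows, njobs);
  bmat_ge0 : forall d j, 0 <= bmat d j;
  polytope_bounded :
    exists M : R, forall y, polytope R bmat y -> forall j, y j ord0 <= M
}.
Arguments weight {R} p _.

Section PSPG.
Variables (R : realType) (I : pspg R).
Implicit Types (p : 'I_(njobs I) -> R) (y : R -> 'cV[R]_(njobs I)).

Definition max_group_size : nat := \max_(S in groups I) #|S|.

Definition feasible y : Prop :=
  (forall t : R, 0 <= t -> polytope R (bmat I) (y t)) /\
  (forall j, measurable_fun (`[0, +oo[ : set R) (fun t : R => y t j ord0)).

Definition processed y (j : 'I_(njobs I)) (t : R) : \bar R :=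
  (\int[lebesgue_measure]_(u in `[0%R, t]) (y u j ord0)%:E)%E.

(* Rates are bounded, so for a feasible schedule the amount processed is
   continuous in t and the infimum is a minimum; it is +oo if the job never
   completes. *)
Definition job_completion p y (j : 'I_(njobs I)) : \bar R :=
  ereal_inf
    [set t%:E | t in [set t : R | 0 <= t /\ ((p j)%:E <= processed y j t)%E]].

Definition group_completion p y (S : {set 'I_(njobs I)}) : \bar R :=
  \big[maxe/0%E]_(j in S) job_completion p y j.

Definition cost p y : \bar R :=
  (\sum_(S in groups I) (weight I S)%:E * group_completion p y S)%E.

Definition opt p : \bar R := ereal_inf [set cost p y | y in feasible].

(* The completions seen up to time t, each with its completion time. *)
Definition observed p y (t : R) : 'I_(njobs I) -> option R :=
  fun j => if (job_completion p y j <= t%:E)%E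
           then Some (fine (job_completion p y j)) else None.

End PSPG.

(* The rate vector at time t is a function of the public data, of t and of the
   completions observed up to t.  The past rates need not be passed: they are
   determined by the algorithm and the past observations. *)
Definition algorithm (R : realType) : Type :=
  forall I : pspg R, R -> ('I_(njobs I) -> option R) -> 'cV[R]_(njobs I).

Definition is_run (R : realType) (A : algorithm R) (I : pspg R)
    (p : 'I_(njobs I) -> R) (y : R -> 'cV[R]_(njobs I)) : Prop :=
  forall t : R, 0 <= t -> y t = A I t (observed p y t).

(* The ratio may depend on the public data of the instance. *)
Definition competitive (R : realType) (A : algorithm R)
    (alpha : pspg R -> R) : Prop :=
  forall (I : pspg R) (p : 'I_(njobs I) -> R), (forall j, 0 <= p j) ->
    (exists y, is_run A p y) /\
    (forall y, is_run A p y ->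
       feasible y /\ (cost p y <= (alpha I)%:E * opt p)%E).

(* Main.v *)
Require Import Defs.
From HB Require Import structures.
From mathcomp Require Import all_boot all_order all_algebra.
From mathcomp Require Import all_classical all_reals all_analysis.
From mathcomp Require Import measurable_realfun ring lra.
Import Order.TTheory GRing.Theory Num.Theory.
Import numFieldNormedType.Exports.
Local Open Scope classical_set_scope.
Local Open Scope ring_scope.

(** At any time with set U of unfinished jobs, every unfinished group S spreads its
    weight evenly over S :&: U; this gives weights W_j with total W.  The algorithm
    runs at (approximately) proportionally fair rates y for W, so that
    sum_j W_j x_j / y_j <= 2 W for every x in the polytope.

    Compare with any schedule z at time T = t / kappa.  Its average rate x over [0, T]
    lies in the polytope, and p_j <= T x_j for all jobs of the groups z has
    finished by T.  AM-GM together with fairness gives, pointwise in t,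
      W(t) <= 2 W_z(t / kappa) + 2 (t / kappa) sum_j W_j(t) y_j(t) / p_j,
    where W_z is the weight of the groups z has not finished.  Integrated over t, the
    last sum costs group S at most w_S C_S sum_(j in S) 1 / k_j, where k_j is the
    number of jobs of S completing no earlier than j: a harmonic sum, at most
    1 + ln g.  With kappa = 4 (1 + ln g) the last term is half the cost of the
    algorithm, hence the ratio 16 (1 + ln g). *)

(** * Proportionally fair points of a packing polytope *)

Section ProportionalFairness.
Variables (R : realType) (D n : nat) (B : 'M[rat]_(D, n)).
Hypothesis B_ge0 : forall d j, 0 <= B d j.

Lemma polytopeE (y : 'cV[R]_n) : polytope R B y <->
  (forall j, 0 <= y j ord0) /\
  (forall d, \sum_j ratr (B d j) * y j ord0 <= 1).
Proof.
have E d : (map_mx ratr B *m y) d ord0 = \sum_j ratr (B d j) * y j ord0.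
  by rewrite mxE; apply: eq_bigr => j _; rewrite mxE.
by split=> -[y0 yB]; split=> // d; move: (yB d); rewrite E.
Qed.

Lemma polytope_convex (x y : 'cV[R]_n) (h : R) : 0 <= h <= 1 ->
  polytope R B x -> polytope R B y -> polytope R B ((1 - h) *: x + h *: y).
Proof.
move=> /andP[h0 h1] /polytopeE[x0 xB] /polytopeE[y0 yB]; apply/polytopeE.
split=> [j|d].
  by rewrite !mxE addr_ge0// mulr_ge0// subr_ge0.
have -> : \sum_j ratr (B d j) * ((1 - h) *: x + h *: y) j ord0 =
    (1 - h) * (\sum_j ratr (B d j) * x j ord0)
    + h * (\sum_j ratr (B d j) * y j ord0).
  rewrite !mulr_sumr -big_split/=; apply: eq_bigr => j _.
  by rewrite !mxE; ring.
have := xB d; have := yB d; move: (\sum_j _) (\sum_j _) => a b a1 b1.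
by nra.
Qed.

Lemma polytope_const_gt0 : exists2 m : R, 0 < m & polytope R B (const_mx m).
Proof.
have b0 d j : 0 <= ratr (B d j) :> R by rewrite ler0q.
(* [s] dominates every row sum of [B]; adding 1 keeps the inverse meaningful when [B] is zero. *)
pose s : R := \sum_d \sum_j ratr (B d j).
have s0 : 0 <= s by do 2 apply: sumr_ge0 => ? _.
exists (1 + s)^-1; first by rewrite invr_gt0 ltr_pwDl.
apply/polytopeE; split=> [j|d]; first by rewrite mxE invr_ge0 addr_ge0.
under eq_bigr do rewrite mxE.
rewrite -mulr_suml ler_pdivrMr ?mul1r ?ltr_pwDl//.
apply: (@le_trans _ _ s); last by rewrite lerDr.
rewrite /s (bigD1 d)//= lerDl; apply: sumr_ge0 => e _.
exact: sumr_ge0.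
Qed.

Hypothesis B_bounded :
  exists M : R, forall y, polytope R B y -> forall j, y j ord0 <= M.

(** Boundedness places the set in a box, and all its constraints are closed. Points are taken as
    rows so that [rV_compact] applies to the box. *)
Lemma polytope_ge_compact (m : R) : 0 <= m ->
  compact [set v : 'rV[R]_n | polytope R B v^T /\ forall j, m <= v ord0 j].
Proof.
move=> m0; have [M yM] := B_bounded.
have cptM :
    compact [set v : 'rV[R]_n | forall j, (`[m, M]%classic : set R) (v ord0 j)].
  apply: (@rV_compact _ _ (fun=> `[m, M]%classic)) => i.
  exact: segment_compact.
apply: subclosed_compact cptM _.
- have -> : [set v : 'rV[R]_n | polytope R B v^T /\ forall j, m <= v ord0 j] =
      (\bigcap_j [set v : 'rV[R]_n | m <= v ord0 j]) `&`
      (\bigcap_d [set v : 'rV[R]_n | \sum_j ratr (B d j) * v ord0 j <= 1]).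
    apply/seteqP; split=> v /=.
      move=> [/polytopeE[_ vB] vm]; split=> [j _|d _] //=.
      by apply: le_trans (vB d); apply: ler_sum => j _; rewrite mxE.
    move=> [vm vB]; split; last by move=> j; exact: vm.
    apply/polytopeE; split=> [j|d].
      by rewrite mxE (le_trans m0)//; exact: vm.
    by apply: le_trans (vB d I); apply: ler_sum => j _; rewrite mxE.
  apply: closedI; apply: closed_bigI => i _.
    apply: (@preimage_closed _ _ (fun v : 'rV[R]_n => v ord0 i) [set x | m <= x]).
      by move=> v _; exact: coord_continuous.
    exact: closed_ge.
  apply: (@preimage_closed _ _ (fun v : 'rV[R]_n => \sum_j ratr (B i j) * v ord0 j)
    [set x | x <= 1]).
    move=> v _; apply: (@cvg_big _ _ _ _ _ _ _ (nbhs v)) => [|j _].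
      exact: add_continuous.
    by apply: (@cvgMr _ _ (nbhs v)); exact: coord_continuous.
  exact: closed_le.
- move=> v [vB vm] j /=; rewrite in_itv/= vm/=.
  by have := yM _ vB j; rewrite mxE.
Qed.


(** The bound ln (1 + a) >= a - 2 a^2 for a >= -1/2 turns the hypothesis into s <= 2 h q for all
    small h, where s is the linear and q the quadratic sum. This replaces differentiation at h =
    0. *)
Lemma ln_first_order (W x : 'I_n -> R) : (forall j, 0 <= W j) ->
  (forall j, -1 <= x j) ->
  (forall h, 0 < h < 1 -> \sum_j W j * ln (1 + h * x j) <= 0) ->
  \sum_j W j * x j <= 0.
Proof.
move=> W0 x1 max0; set s := \sum_j _.
pose q := \sum_j W j * x j ^+ 2.
have q0 : 0 <= q by apply: sumr_ge0 => j _; rewrite mulr_ge0// sqr_ge0.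
have sq h : 0 < h <= 2^-1 -> s <= 2 * h * q.
  move=> /andP[h0 h12].
  rewrite -(ler_pM2l h0) -subr_le0.
  apply: le_trans (max0 h _); last by apply/andP; split; lra.
  rewrite /s /q !mulr_sumr -sumrB; apply: ler_sum => j _.
  have u0 : 0 < 1 + h * x j by have := x1 j; nra.
  have -> : ln (1 + h * x j) = - ln (1 + h * x j)^-1 by rewrite lnV// opprK.
  have := @le_ln1Dx R ((1 + h * x j)^-1 - 1).
  rewrite addrCA subrr addr0 ltrBrDr addNr invr_gt0 => /(_ u0) lnle.
  have -> : h * (W j * x j) - h * (2 * h * (W j * x j ^+ 2)) =
    W j * (h * x j - 2 * (h * x j) ^+ 2) by ring.
  apply: ler_wpM2l => //.
  rewrite -lerN2 opprK; apply: (le_trans lnle).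
  have hx : - 2^-1 <= h * x j by have := x1 j; nra.
  move: (h * x j) u0 hx => a u0 hx.
  rewrite lerBlDr -div1r ler_pdivrMr//.
  have : 0 <= (1 + 2 * a) * a ^+ 2 by rewrite mulr_ge0 ?sqr_ge0//; lra.
  by lra.
rewrite leNgt; apply/negP => s0.
have e0 : 0 < 4 * q + 2 * s by lra.
(* An explicit h small enough that 2 h q < s when s > 0; the term 2 s keeps h at most 1/2 and covers
   q = 0. *)
have h12 : s / (4 * q + 2 * s) <= 2^-1 by rewrite ler_pdivrMr//; lra.
have := sq (s / (4 * q + 2 * s)); rewrite divr_gt0// h12 => /(_ isT).
have -> : 2 * (s / (4 * q + 2 * s)) * q = s * (2 * q / (4 * q + 2 * s)) by ring.
have : 2 * q / (4 * q + 2 * s) < 1 by rewrite ltr_pdivrMr//; lra.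
by nra.
Qed.

(* Maximise the weighted log-rates over the points of the polytope all of whose
   coordinates are at least half those of an interior point m.  Averaging any z with
   m stays in that region, so the first-order condition costs only a factor 2, and
   the logarithm is only ever used on a compact set where it is continuous. *)
Lemma proportional_fair_exists : exists2 delta : R, 0 < delta &
  forall W : 'I_n -> R, (forall j, 0 <= W j) ->
  exists y : 'cV[R]_n, [/\ polytope R B y, forall j, delta <= y j ord0 &
    forall z, polytope R B z ->
      \sum_j W j * (z j ord0 / y j ord0) <= 2 * \sum_j W j].
Proof.
have [m m0 mP] := polytope_const_gt0.
exists (m / 2); first by rewrite divr_gt0.
move=> W W0.
have m20 : 0 < m / 2 by rewrite divr_gt0.
set K := [set v : 'rV[R]_n | polytope R B v^T /\ forall j, m / 2 <= v ord0 j].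
pose f (v : 'rV[R]_n) := \sum_j W j * ln (v ord0 j).
have Km : K !=set0.
  exists (const_mx m); split; first by rewrite trmx_const.
  by move=> j; rewrite mxE; lra.
have Kc : compact K by apply: polytope_ge_compact; exact: ltW.
have fc : {within K, continuous f}.
  apply: continuous_in_subspaceT => v /set_mem [_ vm].
  apply: (@cvg_big _ _ _ _ _ _ _ (nbhs v)) => [|j _].
    exact: add_continuous.
  apply: (@cvgMr _ _ (nbhs v)); apply: (cvg_comp (fun u : 'rV[R]_n => u ord0 j) (@ln R)).
    exact: coord_continuous.
  by apply: continuous_ln; exact: lt_le_trans (vm j).
have [c /set_mem [cP cm] cmax] := compact_EVT_max Km Kc fc.
have c0 j : 0 < c ord0 j by exact: lt_le_trans (cm j).
exists c^T; split=> // [j|z zP]; first by rewrite mxE.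
pose z' : 'cV[R]_n := (1 - 2^-1) *: z + 2^-1 *: const_mx m.
have z'P : polytope R B z'.
  by apply: polytope_convex => //; apply/andP; split; lra.
have z'm j : m / 2 <= z' j ord0.
  rewrite !mxE; have [/(_ j) + _] := zP; lra.
(* On the segment from [c] to [z'] the coordinates are c_j (1 + h (z'_j / c_j - 1)), so maximality
   of [c] is the hypothesis of [ln_first_order]. *)
have fo : \sum_j W j * (z' j ord0 / c ord0 j - 1) <= 0.
  apply: ln_first_order => // [j|h /andP[h0 h1]].
    rewrite lerBrDr addNr divr_ge0//; last exact: ltW.
    exact: le_trans (ltW m20) (z'm j).
  pose v : 'rV[R]_n := ((1 - h) *: c^T + h *: z')^T.
  have vK : K v.
    split; first by rewrite /v trmxK; apply: polytope_convex => //; rewrite !ltW.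
    move=> j; have := cm j; have := z'm j; rewrite !mxE; nra.
  have := cmax v; rewrite mem_set// => /(_ isT).
  rewrite -subr_le0 /f -sumrB; apply: le_trans; apply: ler_sum => j _.
  rewrite -mulrBr; apply: ler_wpM2l => //.
  have v0 : 0 < v ord0 j by apply: lt_le_trans m20 _; case: vK.
  rewrite -ln_div ?posrE//.
  rewrite le_eqVlt; apply/orP; left; apply/eqP; congr ln.
  by rewrite /v !mxE; field; rewrite gt_eqF.
have : \sum_j W j * (z j ord0 / c ord0 j) / 2 <= \sum_j W j * (z' j ord0 / c ord0 j).
  apply: ler_sum => j _; rewrite -mulrA; apply: ler_wpM2l => //.
  rewrite mulrAC ler_pM2r ?invr_gt0//.
  by rewrite !mxE; lra.
move: fo; under eq_bigr do rewrite mulrBr mulr1.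
rewrite sumrB -mulr_suml; under [in X in _ -> _ -> X <= _]eq_bigr do rewrite mxE.
lra.
Qed.

End ProportionalFairness.

(** * Processed amounts and completion times *)

Section Processed.
Variables (R : realType) (I : pspg R).
Implicit Types (p : 'I_(njobs I) -> R) (y : R -> 'cV[R]_(njobs I)).
Implicit Types (j : 'I_(njobs I)) (s t : R).

Lemma rate_bound : exists2 M : R, 0 < M &
  forall v, polytope R (bmat I) v -> forall j, v j ord0 <= M.
Proof.
have [M vM] := polytope_bounded I.
exists (Num.max M 1); first by rewrite lt_max ltr01 orbT.
by move=> v /vM + j => /(_ j) vj; rewrite le_max vj.
Qed.

Lemma feasible_measurable y j (A : set R) : feasible y -> measurable A ->
  A `<=` `[0, +oo[ -> measurable_fun A (EFin \o (fun t => y t j ord0)).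
Proof.
move=> [_ my] mA A0; apply/measurable_EFinP.
exact: measurable_funS (my j).
Qed.

Lemma feasible_ge0 y j t : feasible y -> 0 <= t -> 0 <= y t j ord0.
Proof. by move=> [yP _] /yP [+ _]; exact. Qed.

Lemma processedD y j s t : feasible y -> 0 <= s <= t ->
  (processed y j t = processed y j s +
    \int[lebesgue_measure]_(u in `]s, t]) (y u j ord0)%:E)%E.
Proof.
move=> yF /andP[s0 st]; rewrite /processed.
have E : `[0, t]%classic = `[0, s] `|` `]s, t] :> set R.
  by rewrite -itv_bndbnd_setU// bnd_simp.
rewrite E ge0_integral_setU//.
- rewrite -E; apply: feasible_measurable => // u /=.
  by rewrite !in_itv/= andbT => /andP[].
- move=> u; rewrite -E/= in_itv/= => /andP[u0 _].
  by rewrite lee_fin feasible_ge0.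
- apply/disj_setPS => u [] /=; rewrite !in_itv/= => /andP[_ us] /andP[su _].
  by have := lt_le_trans su us; rewrite ltxx.
Qed.

Lemma integral_rate_ge0 y j (A : set R) : feasible y -> A `<=` `[0, +oo[ ->
  (0 <= \int[lebesgue_measure]_(u in A) (y u j ord0)%:E)%E.
Proof.
move=> yF A0; apply: integral_ge0 => u /A0 /=; rewrite in_itv/= andbT => u0.
by rewrite lee_fin feasible_ge0.
Qed.

Lemma processed_ge0 y j t : feasible y -> (0 <= processed y j t)%E.
Proof.
move=> yF; apply: integral_rate_ge0 => // u /=.
by rewrite !in_itv/= andbT => /andP[].
Qed.

Lemma processed_le y j s t : feasible y -> 0 <= s <= t ->
  (processed y j s <= processed y j t)%E.
Proof.
move=> yF /andP[s0 st]; rewrite (@processedD y j s t) ?s0//.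
rewrite leeDl// integral_rate_ge0// => u /=.
by rewrite !in_itv/= andbT => /andP[/ltW su _]; exact: le_trans su.
Qed.

Lemma integral_rate_le y j s t (M : R) : feasible y -> 0 <= s <= t ->
  (forall u, 0 <= u -> y u j ord0 <= M) ->
  (\int[lebesgue_measure]_(u in `]s, t]) (y u j ord0)%:E <= (M * (t - s))%:E)%E.
Proof.
move=> yF /andP[s0 st] yM.
have sub : `]s, t] `<=` (`[0, +oo[%classic : set R).
  by move=> u /=; rewrite !in_itv/= andbT => /andP[/ltW su _]; exact: le_trans su.
apply: (@le_trans _ _ (\int[lebesgue_measure]_(u in `]s, t]) (cst M%:E u))%E).
  apply: ge0_le_integral => //=.
  - by move=> u /sub /=; rewrite in_itv/= andbT lee_fin => u0; exact: feasible_ge0.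
  - exact: feasible_measurable.
  - by move=> u /sub /=; rewrite in_itv/= andbT lee_fin => u0; exact: yM.
rewrite integral_cst//= lebesgue_measure_itv/= lte_fin.
case: ltP => [_|ts]; first by rewrite -EFinB -EFinM.
by rewrite mule0 lee_fin (@le_anti _ _ s t) ?st ?ts// subrr mulr0.
Qed.

Lemma processed0 y j : processed y j 0 = 0%E.
Proof. by rewrite /processed set_itv1 integral_set1. Qed.

Lemma processed_fin y j t : feasible y -> 0 <= t -> processed y j t \is a fin_num.
Proof.
move=> yF t0; have [M M0 vM] := rate_bound.
rewrite ge0_fin_numE ?processed_ge0//.
rewrite (@processedD y j 0 t) ?lexx// processed0 add0e.
apply: le_lt_trans (ltry (M * (t - 0))).
apply: integral_rate_le; rewrite ?lexx// => u u0.
by apply: vM; case: yF => + _; exact.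
Qed.

(** The infimum defining the completion time is attained: with rates at most M, work missing at time
    t needs at least a further (missing work) / M of time. *)
Lemma job_completion_leE p y j t : feasible y -> 0 <= t ->
  (job_completion p y j <= t%:E)%E = ((p j)%:E <= processed y j t)%E.
Proof.
move=> yF t0; apply/idP/idP; last first.
  by move=> pt; apply: ereal_inf_lbound; exists t.
apply: contraTT; rewrite -!ltNge => lt_p.
have [M M0 vM] := rate_bound.
have Pfin := processed_fin y j t yF t0.
pose e := (p j - fine (processed y j t)) / M.
have e0 : 0 < e by rewrite divr_gt0// subr_gt0 -lte_fin fineK.
apply: (@lt_le_trans _ _ (t + e)%:E); first by rewrite lte_fin ltrDl.
apply: le_ereal_inf_tmp => _ [s [s0 ps] <-]; rewrite lee_fin.
have [st|ts] := leP s t.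
  by have := lt_le_trans lt_p (le_trans ps (processed_le y j s t yF _));
    rewrite s0 st ltxx => /(_ isT).
move: ps; rewrite (@processedD y j t s) ?t0 ?(ltW ts)// => ps.
have ub : (\int[lebesgue_measure]_(u in `]t, s]) (y u j ord0)%:E <= (M * (s - t))%:E)%E.
  apply: integral_rate_le; rewrite ?t0 ?(ltW ts)// => u u0.
  by apply: vM; case: yF => + _; exact.
have := le_trans ps (leeD2l (processed y j t) ub).
rewrite -[processed y j t]fineK// -EFinD lee_fin => {}ps.
rewrite addrC -lerBrDr /e ler_pdivrMr//; lra.
Qed.

Lemma job_completion_ltE p y j t : feasible y -> 0 <= t ->
  (t%:E < job_completion p y j)%E = (processed y j t < (p j)%:E)%E.
Proof. by move=> yF t0; rewrite !ltNge job_completion_leE. Qed.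

Lemma job_completion_ge0 p y j : (0 <= job_completion p y j)%E.
Proof. by apply: le_ereal_inf_tmp => _ [s [s0 _] <-]; rewrite lee_fin. Qed.

Lemma group_completion_ge0 p y (S : {set 'I_(njobs I)}) :
  (0 <= group_completion p y S)%E.
Proof. exact: bigmax_ge_id. Qed.

(** No overshoot is possible: with rates at most M, an excess at time c would mean that the
    requirement was already met at the earlier time c - excess / M. *)
Lemma processed_completion_le p y j (c : R) : feasible y -> 0 <= p j ->
  job_completion p y j = c%:E -> (processed y j c <= (p j)%:E)%E.
Proof.
move=> yF p0 jc; have [M M0 vM] := rate_bound.
have c0 : 0 <= c by rewrite -lee_fin -jc job_completion_ge0.
have Pfin := processed_fin y j c yF c0.
rewrite leNgt; apply/negP => lt_p.
have yM u : 0 <= u -> y u j ord0 <= M.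
  by move=> u0; apply: vM; case: yF => + _; exact.
pose s := c - (fine (processed y j c) - p j) / M.
have sc : s < c by rewrite /s ltrBlDr ltrDl divr_gt0// subr_gt0 -lte_fin fineK.
have s0 : 0 <= s.
  rewrite subr_ge0 ler_pdivrMr//.
  have : (processed y j c <= (M * (c - 0))%:E)%E.
    rewrite (@processedD y j 0 c) ?lexx// processed0 add0e.
    by apply: integral_rate_le; rewrite ?lexx.
  by rewrite -[processed y j c]fineK// lee_fin; lra.
suff : (job_completion p y j <= s%:E)%E by rewrite jc lee_fin leNgt sc.
rewrite job_completion_leE//.
have Pfs := processed_fin y j s yF s0.
have : (processed y j c <= processed y j s + (M * (c - s))%:E)%E.
  rewrite (@processedD y j s c) ?s0 ?(ltW sc)// leeD2l//.
  by apply: integral_rate_le; rewrite ?s0 ?(ltW sc).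
rewrite -[processed y j c]fineK// -[processed y j s]fineK// -EFinD !lee_fin.
have -> : M * (c - s) = fine (processed y j c) - p j.
  by rewrite /s; field; rewrite gt_eqF.
by lra.
Qed.

Lemma eq_processed y y' j t : feasible y -> feasible y' -> 0 <= t ->
  (forall u, 0 <= u < t -> y u = y' u) -> processed y j t = processed y' j t.
Proof.
move=> yF yF' t0 yy'; rewrite /processed.
have sub : `[0, t[ `<=` (`[0, +oo[%classic : set R).
  by move=> u /=; rewrite !in_itv/= andbT => /andP[].
rewrite -!integral_itv_bndo_bndc; try exact: feasible_measurable.
apply: eq_integral => u; rewrite inE/= in_itv/= => ut.
by rewrite yy'.
Qed.

Definition alive p y t : {set 'I_(njobs I)} :=
  [set j | (t%:E < job_completion p y j)%E].

Lemma alive_le p y s t : s <= t -> alive p y t \subset alive p y s.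
Proof.
move=> st; apply/fintype.subsetP => j; rewrite !inE; apply: le_lt_trans.
by rewrite lee_fin.
Qed.

(** A single instant has measure zero, so the rate at t does not influence which jobs are unfinished
    at t. Hence the equation y t = r (alive p y t) is not circular. *)
Lemma eq_alive p y y' t : feasible y -> feasible y' -> 0 <= t ->
  (forall u, 0 <= u < t -> y u = y' u) -> alive p y t = alive p y' t.
Proof.
move=> yF yF' t0 yy'; apply/setP => j; rewrite !inE.
by rewrite !job_completion_ltE// (@eq_processed y y').
Qed.

End Processed.
Arguments alive {R I} p y t.

(** * Runs of a rule whose rates depend only on the set of unfinished jobs *)

Section Runs.
Variables (R : realType) (I : pspg R) (p : 'I_(njobs I) -> R).
Variable r : {set 'I_(njobs I)} -> 'cV[R]_(njobs I).
Hypothesis r_polytope : forall U, polytope R (bmat I) (r U).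
Implicit Types (y : R -> 'cV[R]_(njobs I)).

Lemma alive_measurable y U : measurable [set t | alive p y t = U].
Proof.
have -> : [set t | alive p y t = U] =
    \bigcap_(i : 'I_(njobs I))
      [set t | (t%:E < job_completion p y i)%E = (i \in U)].
  apply/seteqP; split=> t /=.
    by move=> <- i _ /=; rewrite inE.
  by move=> tU; apply/setP => i; rewrite inE; exact: (tU i Logic.I).
apply: fin_bigcap_measurable => [|i _]; first exact: finite_finset.
have mlt : measurable [set t : R | (t%:E < job_completion p y i)%E].
  case: (job_completion p y i) => [c| |] /=.
  - suff -> : [set t : R | (t%:E < c%:E)%E] = `]-oo, c[%classic by [].
    by apply/seteqP; split=> t /=; rewrite in_itv/= lte_fin.
  - suff -> : [set t : R | (t%:E < +oo)%E] = setT by [].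
    by apply/seteqP; split=> t //= _; rewrite ltry.
  - suff -> : [set t : R | (t%:E < -oo)%E] = set0 by [].
    by apply/seteqP; split=> t //=; rewrite ltNge leNye.
case: (i \in U); first exact: mlt.
suff -> : [set t | (t%:E < job_completion p y i)%E = false] =
    ~` [set t : R | (t%:E < job_completion p y i)%E] by exact: measurableC.
by apply/seteqP; split=> t /=; [move=> ->|move=> /negP/negbTE].
Qed.

(** A run takes finitely many values, each on a measurable set of times, so its coordinates are
    finite combinations of indicators. *)
Lemma run_feasible y : (forall t : R, 0 <= t -> y t = r (alive p y t)) -> feasible y.
Proof.
move=> yr; split=> [t t0|j]; first by rewrite yr.
apply: (@eq_measurable_fun _ _ _ _ _
  (fun t => \sum_U r U j ord0 * \1_[set t | alive p y t = U] t)).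
  move=> t; rewrite inE/= in_itv/= andbT => t0.
  rewrite yr// (bigD1 (alive p y t))//= indicE mem_set// mulr1 big1 ?addr0// => U UA.
  rewrite indicE memNset ?mulr0// => /= UA'.
  by move: UA; rewrite UA' eqxx.
apply: measurable_sum => U; apply: measurable_funM; first exact: measurable_cst.
by apply: measurable_indic; exact: alive_measurable.
Qed.

Lemma switch_feasible y (s : R) v : feasible y -> polytope R (bmat I) v ->
  feasible (fun t => if t < s then y t else v).
Proof.
move=> [yP ym] vP; split=> [t t0|j]; first by case: ifP => // _; exact: yP.
rewrite (_ : (fun t => _) = (fun t => if t < s then y t j ord0 else v j ord0)).
  apply: measurable_fun_if => //.
  - exact: measurable_fun_ltr.
  - by apply: measurable_funS (ym j) => // t [].
by apply/funext => t; case: ifP.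
Qed.

(** Induction on the number of jobs unfinished at s. The schedule obeys the rule up to s and then
    keeps its rates frozen; if some job finishes later, the rates are updated at the first such
    completion, where fewer jobs remain. *)
Lemma run_step y (s : R) : feasible y -> 0 <= s ->
  (forall t : R, 0 <= t < s -> y t = r (alive p y t)) ->
  (forall t : R, s <= t -> y t = r (alive p y s)) ->
  exists y', forall t : R, 0 <= t -> y' t = r (alive p y' t).
Proof.
have [k] := ubnP #|alive p y s|; elim: k y s => // k IH y s /ltnSE Uk yF s0 ylt yge.
have [[t [st Ut]]|same] :=
    pselect (exists t, s <= t /\ alive p y t != alive p y s); last first.
  exists y => t t0; have [ts|st] := ltP t s; first by rewrite ylt// t0.
  rewrite yge//; congr r; apply/eqP; rewrite eq_sym; apply/negPn/negP => Ut.
  by apply: same; exists t.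
have : ~~ (alive p y s \subset alive p y t).
  by move: Ut; rewrite finset.eqEsubset alive_le.
move=> /fintype.subsetPn[j0 j0s j0t].
(* The first job to finish after s; its completion time [c] is finite because [j0] is finished by
   t. *)
have [j js jmin] := @arg_minP _ _ _ j0 (mem (alive p y s)) (job_completion p y) j0s.
have jt : (job_completion p y j <= t%:E)%E.
  apply: le_trans (jmin j0 j0s) _; move: j0t; rewrite inE -leNgt//.
have [c cE] : exists c, job_completion p y j = c%:E.
  have := job_completion_ge0 _ _ p y j.
  by case: (job_completion p y j) jt => // c _ _; exists c.
have sc : s < c by move: (js : j \in alive p y s); rewrite inE cE lte_fin.
have c0 : 0 <= c by apply: ltW; exact: le_lt_trans sc.
have alive_c u : s <= u -> u < c -> alive p y u = alive p y s.
  move=> su uc; apply/eqP; rewrite finset.eqEsubset alive_le//=.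
  apply/fintype.subsetP => i /jmin; rewrite cE inE; apply: lt_le_trans.
  by rewrite lte_fin.
pose y' t := if t < c then y t else r (alive p y c).
have yF' : feasible y' by apply: switch_feasible.
have yy' u : u < c -> y u = y' u by move=> uc; rewrite /y' uc.
have alive' u : 0 <= u <= c -> alive p y' u = alive p y u.
  move=> /andP[u0 uc]; apply/esym/eq_alive => // v /andP[_ vu].
  by apply: yy'; exact: lt_le_trans uc.
apply: (IH y' c) => //.
- rewrite alive' ?c0 ?lexx//; apply: leq_trans Uk; apply: proper_card.
  apply/properP; split; first by apply: alive_le; exact: ltW.
  by exists j => //; rewrite inE cE ltxx.
- move=> u /andP[u0 uc]; rewrite -yy'// alive' ?u0 ?ltW//.
  by have [us|su] := ltP u s; [rewrite ylt ?u0|rewrite yge// alive_c].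
- by move=> u cu; rewrite alive' ?c0 ?lexx// /y' ltNge cu.
Qed.

Lemma run_exists : exists y, forall t : R, 0 <= t -> y t = r (alive p y t).
Proof.
pose y0 v := fun _ : R => v : 'cV[R]_(njobs I).
have y0F U : feasible (y0 (r U)).
  by split=> [t _|j]; [exact: r_polytope|exact: measurable_cst].
(* The unfinished set at time 0 is the same for all feasible schedules, so the inner [r finset.set0]
   is an arbitrary placeholder. *)
apply: (@run_step (y0 (r (alive p (y0 (r finset.set0)) 0))) 0) => //.
- by move=> t /andP[t0 /(le_lt_trans t0)]; rewrite ltxx.
- move=> t _; congr r; apply: eq_alive => // u /andP[u0 /(le_lt_trans u0)].
  by rewrite ltxx.
Qed.

Lemma job_completion_bound y j (delta : R) : feasible y -> 0 < delta ->
  0 <= p j -> (forall t : R, 0 <= t -> delta <= y t j ord0) ->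
  (job_completion p y j <= (p j / delta)%:E)%E.
Proof.
move=> yF d0 p0 dy; have pd0 : 0 <= p j / delta by rewrite divr_ge0// ltW.
have sub : `[0, p j / delta] `<=` (`[0, +oo[%classic : set R).
  by move=> u /=; rewrite !in_itv/= andbT => /andP[].
rewrite job_completion_leE//.
apply: (@le_trans _ _
    (\int[lebesgue_measure]_(u in `[0%R, (p j / delta)%R]) (cst delta%:E u))%E).
  rewrite integral_cst//= lebesgue_measure_itv/= lte_fin.
  case: ltP => [_|ts]; first by rewrite -EFinB -EFinM lee_fin subr0 mulrC divfK// gt_eqF.
  by rewrite mule0 lee_fin; move: ts; rewrite ler_pdivrMr// mul0r.
apply: ge0_le_integral => //=.
- by move=> u _; rewrite lee_fin ltW.
- exact: feasible_measurable.
- by move=> u /sub /=; rewrite in_itv/= andbT lee_fin => u0; exact: dy.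
Qed.

End Runs.

(** * The harmonic sum, and the comparison with another schedule at a fixed time *)

Section Competitiveness.
Variable R : realType.

(* Removing the earliest completion from S removes the term #|S|^-1. *)
Lemma sum_inv_rank_le (T : finType) (c : T -> R) (S : {set T}) :
  \sum_(j in S) (#|[set i in S | c j <= c i]%SET|%:R)^-1 <= 1 + ln (#|S|%:R) :> R.
Proof.
have [k] := ubnP #|S|; elim: k S => // k IH S /ltnSE Sk.
(* For the empty set, ln 0 = 0 by convention and the bound reads 0 <= 1. *)
have [->|[j0 j0S]] := set_0Vmem S.
  by rewrite big_set0 cards0 ln0// addr0.
have [j jS jmin] := @arg_minP _ _ _ j0 (mem S) c j0S.
have {}jS : j \in S by [].
rewrite (big_setD1 j)//=.
have -> : [set i in S | c j <= c i]%SET = S.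
  by apply/setP => i; rewrite inE andbC; case: (boolP (i \in S));
    rewrite ?andbF// => /jmin ->.
have SD : #|S| = #|S :\ j|.+1 by rewrite (cardsD1 j) jS.
have {}IH : \sum_(i in S :\ j) (#|[set l in S | c i <= c l]%SET|%:R)^-1
    <= 1 + ln (#|S :\ j|%:R) :> R.
  apply: le_trans (IH (S :\ j) _); last by rewrite -SD.
  apply: ler_sum => i iS; rewrite lef_pV2 ?posrE ?ltr0n; last first.
  - by apply/card_gt0P; exists i; rewrite inE iS lexx.
  - by apply/card_gt0P; exists i; move: iS; rewrite !inE lexx => /andP[_ ->].
  rewrite ler_nat subset_leq_card//; apply/fintype.subsetP => l.
  by rewrite !inE => /andP[/andP[_ ->] ->].
have [S0|S0] := posnP #|S :\ j|.
  rewrite SD S0 ln1 invr1 addr0 (_ : S :\ j = finset.set0) ?big_set0 ?addr0//.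
  by apply/eqP; rewrite -cards_eq0 S0.
apply: le_trans (lerD (lexx _) IH) _; rewrite SD.
move: #|S :\ j| S0 => n n0.
have n1 : 0 < n.+1%:R :> R by rewrite ltr0n.
have n0' : 0 < n%:R :> R by rewrite ltr0n.
(* This yields 1 / (n + 1) <= ln (n + 1) - ln n. It requires n > 0, so the singleton was treated
   apart. *)
have := @le_ln1Dx R (- (n.+1%:R)^-1).
rewrite ltrN2 invf_lt1// ltr1n ltnS n0 => /(_ isT).
have -> : 1 - (n.+1%:R)^-1 = n%:R / n.+1%:R :> R.
  by rewrite -natr1; field; rewrite natr1 gt_eqF.
rewrite ln_div ?posrE//.
move: (ln _) (ln _) (_^-1) => a b e; lra.
Qed.

Variable I : pspg R.
Implicit Types (p : 'I_(njobs I) -> R) (y z : R -> 'cV[R]_(njobs I)).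
Implicit Types (j : 'I_(njobs I)) (S U : {set 'I_(njobs I)}).

(** Each row constraint is linear, so integrating it over [0, T] and dividing by T gives the same
    constraint for the average. *)
Lemma average_rate z (T : R) : feasible z -> 0 < T ->
  exists2 x, polytope R (bmat I) x &
    forall j, (T * x j ord0)%:E = processed z j T.
Proof.
move=> zF T0; have T0' := ltW T0.
have sub : `[0, T] `<=` (`[0, +oo[%classic : set R).
  by move=> u /=; rewrite !in_itv/= andbT => /andP[].
have Pf j : processed z j T \is a fin_num by exact: processed_fin.
exists (\col_j (fine (processed z j T) / T)); last first.
  by move=> j; rewrite mxE mulrC divfK ?gt_eqF// fineK.
apply/polytopeE; split=> [j|d].
  by rewrite mxE divr_ge0// fine_ge0// processed_ge0.
under eq_bigr do rewrite mxE mulrA.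
rewrite -mulr_suml ler_pdivrMr// mul1r -lee_fin -sumEFin.
have b0 j : 0 <= ratr (bmat I d j) :> R by rewrite ler0q bmat_ge0.
have mz j := feasible_measurable _ _ z j `[0, T]%classic zF (measurable_itv _) sub.
have z0 j (u : R) : `[0, T]%classic u -> (0 <= (z u j ord0)%:E)%E.
  by move=> /sub /=; rewrite in_itv/= andbT => u0; rewrite lee_fin feasible_ge0.
have E j : (ratr (bmat I d j) * fine (processed z j T))%:E =
    (\int[lebesgue_measure]_(u in `[0%R, T])
      ((ratr (bmat I d j))%:E * (z u j ord0)%:E))%E.
  rewrite EFinM fineK// ge0_integralZl_EFin//.
  - by move=> u; exact: z0.
  - exact: mz.
rewrite (eq_bigr _ (fun j _ => E j)).
rewrite -ge0_integral_sum//=; first last.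
- by move=> j u /z0 zu; rewrite mule_ge0// lee_fin.
- by move=> j; apply: measurable_funeM; exact: mz.
apply: (@le_trans _ _ (\int[lebesgue_measure]_(u in `[0%R, T]) (cst 1%:E u))%E).
  apply: ge0_le_integral => //=.
  - move=> u u0; apply: sume_ge0 => j _.
    by rewrite mule_ge0// ?lee_fin//; exact: z0.
  - apply: emeasurable_sum => j; apply: measurable_funeM; exact: mz.
  - move=> u /sub /=; rewrite in_itv/= andbT => u0.
    rewrite sumEFin lee_fin.
    by have [/(_ u u0)/polytopeE[_ +] _] := zF; exact.
rewrite integral_cst//= lebesgue_measure_itv/= lte_fin T0.
by rewrite -EFinB -EFinM lee_fin subr0 mul1r.
Qed.

Definition fair_weight U j : R :=
  \sum_(S in groups I | j \in S :&: U) weight I S / #|S :&: U|%:R.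

Lemma fair_weight_sum U (g : 'I_(njobs I) -> R) :
  \sum_j fair_weight U j * g j =
  \sum_(S in groups I) \sum_(j in S :&: U) weight I S / #|S :&: U|%:R * g j.
Proof.
under eq_bigr do rewrite /fair_weight mulr_suml.
rewrite (exchange_big_dep (mem (groups I)))//=; last by move=> j S _ /andP[].
by apply: eq_bigr => S ->.
Qed.

Lemma group_share_ge0 U S : S \in groups I -> 0 <= weight I S / #|S :&: U|%:R :> R.
Proof. by move=> SI; rewrite divr_ge0// ltW// weight_gt0. Qed.

Lemma fair_weight_ge0 U j : 0 <= fair_weight U j.
Proof. by apply: sumr_ge0 => S /andP[SI _]; exact: group_share_ge0. Qed.

Lemma fair_weight_total U :
  \sum_j fair_weight U j =
  \sum_(S in groups I | S :&: U != finset.set0) weight I S.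
Proof.
under eq_bigr do rewrite -[fair_weight _ _]mulr1.
rewrite fair_weight_sum big_mkcondr/=; apply: eq_bigr => S _.
case: eqP => [->|/eqP S0] /=; first by rewrite big_set0.
rewrite sumr_const mulr1 -[LHS]mulr_natr divfK//.
by rewrite pnatr_eq0 cards_eq0.
Qed.

(* The pairs (S, j) with S done before T in the other schedule satisfy
   p j <= T * x j, so 1 <= T * y j / p j + x j / (4 * y j) by AM-GM; summing the last
   term against the fair weights loses at most half of their total. *)
Lemma alive_weight_le p U (done : pred {set 'I_(njobs I)}) (y x : 'cV[R]_(njobs I)) (T : R) :
  0 < T -> (forall j, j \in U -> 0 < p j) -> (forall j, 0 < y j ord0) ->
  \sum_j fair_weight U j * (x j ord0 / y j ord0) <= 2 * \sum_j fair_weight U j ->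
  (forall S, S \in groups I -> done S -> forall j, j \in S -> p j <= T * x j ord0) ->
  (forall j, 0 <= x j ord0) ->
  \sum_(S in groups I | S :&: U != finset.set0) weight I S <=
  2 * (\sum_(S in groups I | ~~ done S) weight I S) +
  2 * T * (\sum_(S in groups I) \sum_(j in S :&: U)
    weight I S / #|S :&: U|%:R * (y j ord0 / p j)).
Proof.
move=> T0 p0 y0 fair px x0; rewrite -fair_weight_total.
move: fair; rewrite fair_weight_sum.
set X := \sum_(S in _) _; set A := \sum_j _; set N := \sum_(S in _ | _) _.
set Q := \sum_(S in _) _ => XA.
suff : A <= N + T * Q + X / 4 by lra.
rewrite /A /N /Q /X {XA A N Q X}.
under eq_bigr do rewrite -[fair_weight _ _]mulr1.
rewrite fair_weight_sum [X in _ <= X + _ + _]big_mkcondr/=.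
rewrite mulr_sumr mulr_suml -!big_split/=.
apply: ler_sum => S SI; have w0 := weight_gt0 SI.
have a0 := @group_share_ge0 U S SI.
have Q0 : 0 <= T * \sum_(j in S :&: U) weight I S / #|S :&: U|%:R * (y j ord0 / p j).
  apply: mulr_ge0; first exact: ltW.
  apply: sumr_ge0 => j; rewrite inE => /andP[_ jU].
  by rewrite mulr_ge0// divr_ge0// ltW ?p0.
have X0 : 0 <= (\sum_(j in S :&: U) weight I S / #|S :&: U|%:R * (x j ord0 / y j ord0)) / 4.
  rewrite divr_ge0//; apply: sumr_ge0 => j _.
  by rewrite mulr_ge0// divr_ge0// ltW.
(* A group not done is paid in full by its own weight; a done group is paid job by job through
   AM-GM. *)
have [dS|ndS] /= := boolP (done S); last first.
  suff : \sum_(j in S :&: U) weight I S / #|S :&: U|%:R * 1 <= weight I S by lra.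
  rewrite sumr_const mulr1 -[leLHS]mulr_natr.
  have [->|S0] := eqVneq #|S :&: U| 0%N; first by rewrite mulr0 ltW.
  by rewrite divfK// pnatr_eq0.
rewrite add0r mulr_sumr mulr_suml -big_split/=; apply: ler_sum => j.
rewrite inE => /andP[jS jU].
have yj := y0 j; have pj := p0 j jU; have pxj := px S SI dS j jS.
rewrite mulrCA -[X in _ <= _ + X]mulrA -mulrDr; apply: ler_wpM2l => //.
move: (y j ord0) (p j) (x j ord0) yj pj pxj (x0 j) => a b e a0' b0 be e0.
(* AM-GM as a completed square: with u = T a / b, u + 1 / (4 u) - 1 = (2 u - 1)^2 / (4 u). *)
have h : 1 <= T * (a / b) + b / T / a / 4.
  have -> : T * (a / b) + b / T / a / 4 = ((2 * T * a - b) ^+ 2 / (4 * T * a * b)) + 1.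
    by field; rewrite !gt_eqF.
  by rewrite lerDr divr_ge0 ?sqr_ge0// ltW// !mulr_gt0.
apply: (le_trans h); rewrite lerD2l ler_pM2r// ler_pM2r ?invr_gt0//.
by rewrite ler_pdivrMr// mulrC.
Qed.

End Competitiveness.

(** * Integration over time and the cost of the fair run *)

Section FairRun.
Variables (R : realType) (I : pspg R).
Implicit Types (p : 'I_(njobs I) -> R) (y z : R -> 'cV[R]_(njobs I)).
Implicit Types (j : 'I_(njobs I)) (S U : {set 'I_(njobs I)}).

(** The lower bound [delta] is uniform in [U], which guarantees that every job of a run finishes in
    finite time. *)
Lemma fair_rates_exists : exists r : {set 'I_(njobs I)} -> 'cV[R]_(njobs I),
  exists2 delta : R, 0 < delta & forall U,
    [/\ polytope R (bmat I) (r U), forall j, delta <= r U j ord0 &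
      forall x, polytope R (bmat I) x ->
        \sum_j fair_weight R I U j * (x j ord0 / r U j ord0) <=
        2 * \sum_j fair_weight R I U j].
Proof.
have [delta d0 dP] := proportional_fair_exists R _ _ (bmat I) (@bmat_ge0 R I)
  (@polytope_bounded R I).
have /choice[r rP] U := dP _ (fair_weight_ge0 R I U).
by exists r, delta.
Qed.

Definition fair_rates : {set 'I_(njobs I)} -> 'cV[R]_(njobs I) :=
  sval (cid fair_rates_exists).

Lemma ge0_integral_sumZ (T : finType) (P : pred T) (a : T -> R) (f : T -> R -> R) :
  (forall i, P i -> 0 <= a i) ->
  (forall i, measurable_fun (`[0, +oo[%classic : set R) (f i)) ->
  (forall i (t : R), 0 <= t -> 0 <= f i t) ->
  (\int[lebesgue_measure]_(t in `[0%R, +oo[) (\sum_(i | P i) a i * f i t)%:E =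
   \sum_(i | P i) (a i)%:E * \int[lebesgue_measure]_(t in `[0%R, +oo[) (f i t)%:E)%E.
Proof.
move=> a0 mf f0.
have f0' i (t : R) : `[0, +oo[%classic t -> (0 <= (f i t)%:E)%E.
  by rewrite /= in_itv/= andbT lee_fin; exact: f0.
rewrite [RHS]big_mkcond/=.
have E i : (if P i then (a i)%:E * \int[lebesgue_measure]_(t in `[0%R, +oo[) (f i t)%:E
      else 0)%E =
    (\int[lebesgue_measure]_(t in `[0%R, +oo[)
      ((if P i then a i else 0)%:E * (f i t)%:E))%E.
  rewrite ge0_integralZl_EFin//.
  - by case: ifP => // _; rewrite mul0e.
  - by move=> t; exact: f0'.
  - apply/measurable_EFinP; exact: mf.
  - by case: ifP => // /a0.
rewrite (eq_bigr _ (fun i _ => E i)) -ge0_integral_sum//=.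
- apply: eq_integral => t _; rewrite sumEFin big_mkcond/=; congr EFin.
  by apply: eq_bigr => i _; case: ifP => // _; rewrite mul0r.
- by move=> i; apply: measurable_funeM; apply/measurable_EFinP; exact: mf.
- move=> i t /f0' ft; rewrite mule_ge0//.
  by case: ifP => // /a0.
Qed.

Lemma integral_rate_before y j (c : R) : feasible y -> 0 <= c ->
  (\int[lebesgue_measure]_(t in `[0%R, +oo[) (y t j ord0 * (t < c)%R%:R)%:E =
   processed y j c)%E.
Proof.
move=> yF c0; rewrite /processed -integral_itv_bndo_bndc; last first.
  apply: feasible_measurable => // u /=.
  by rewrite !in_itv/= andbT => /andP[].
have -> : `[0, c[%classic = `[0, +oo[ `&` `[0, c[ :> set R.
  apply/seteqP; split=> u /=; rewrite !in_itv/= andbT; last by case.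
  by move=> /andP[-> ->].
rewrite integral_mkcondr; apply: eq_integral => u; rewrite inE/= in_itv/= andbT => u0.
rewrite patchE; case: ifPn => [/set_mem|/negP uc] /=.
  by rewrite in_itv/= u0/= => ->; rewrite mulr1.
case: (ltP u c) => [uc'|_]; last by rewrite mulr0.
by exfalso; apply: uc; apply/mem_set => /=; rewrite in_itv/= u0.
Qed.

Lemma integral_lt (c : R) : 0 <= c ->
  (\int[lebesgue_measure]_(t in `[0%R, +oo[) ((t < c)%R%:R)%:E = c%:E)%E.
Proof.
move=> c0.
under eq_integral => t.
  rewrite inE/= in_itv/= andbT => t0.
  have -> : (t < c)%R%:R = \1_(`[0, c[%classic : set R) t :> R.
    rewrite indicE; congr (_%:R); congr nat_of_bool.
    apply/idP/idP => [tc|/set_mem/=]; last by rewrite in_itv/= t0.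
    by apply/mem_set; rewrite /= in_itv/= t0.
  over.
rewrite integral_indic//= (_ : _ `&` _ = `[0, c[%classic); last first.
  apply/seteqP; split=> u /=; rewrite !in_itv/= andbT; first by case.
  by move=> /andP[-> ->].
rewrite lebesgue_measure_itv/= lte_fin; case: ltP => [_|c0'].
  by rewrite -EFinB subr0.
by rewrite (@le_anti _ _ c 0) ?c0 ?c0'.
Qed.

Lemma measurable_lt (c : R) (D : set R) : measurable D ->
  measurable_fun D (fun t : R => (t < c)%R%:R : R).
Proof.
move=> mD; rewrite (_ : (fun t => _) = \1_(`]-oo, c[%classic : set R)).
  exact: measurable_indic.
apply/funext => t; rewrite indicE; congr (_%:R); congr nat_of_bool.
apply/idP/idP => [tc|/set_mem/=]; last by rewrite in_itv.
by apply/mem_set; rewrite /= in_itv.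
Qed.

(** The pointwise hypothesis is integrated over t >= 0: the indicator of t < e integrates to e, and
    the rate of j cut off at c_j integrates to the work done on j by c_j. *)
Lemma weighted_completion_le (y : R -> 'cV[R]_(njobs I))
    (w1 w2 e1 e2 : {set 'I_(njobs I)} -> R)
    (c : 'I_(njobs I) -> R) (b : {set 'I_(njobs I)} -> 'I_(njobs I) -> R)
    (G : {set {set 'I_(njobs I)}}) :
  feasible y -> (forall S, S \in G -> 0 <= w1 S) ->
  (forall S, S \in G -> 0 <= w2 S) ->
  (forall S, S \in G -> 0 <= e1 S) -> (forall S, S \in G -> 0 <= e2 S) ->
  (forall j, 0 <= c j) -> (forall S j, S \in G -> 0 <= b S j) ->
  (forall t : R, 0 <= t -> \sum_(S in G) w1 S * (t < e1 S)%R%:R <=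
    \sum_(S in G) w2 S * (t < e2 S)%R%:R +
    \sum_(S in G) \sum_(j in S) b S j * (y t j ord0 * (t < c j)%R%:R)) ->
  \sum_(S in G) w1 S * e1 S <=
    \sum_(S in G) w2 S * e2 S +
    \sum_(S in G) \sum_(j in S) b S j * fine (processed y j (c j)).
Proof.
move=> yF w10 w20 e10 e20 c0 b0 pt.
pose D : set R := `[0, +oo[%classic.
have DP (t : R) : D t -> 0 <= t by rewrite /D/= in_itv/= andbT.
have mlt (a : R) : measurable_fun D (fun t : R => (t < a)%R%:R : R).
  by apply: measurable_lt; exact: measurable_itv.
have myl j : measurable_fun D (fun t => y t j ord0 * (t < c j)%R%:R).
  by apply: measurable_funM => //; case: yF => _; exact.
have yl0 j (t : R) : 0 <= t -> 0 <= y t j ord0 * (t < c j)%R%:R.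
  by move=> t0; rewrite mulr_ge0// feasible_ge0.
(* Flattening to a sum over pairs lets [ge0_integral_sumZ] serve the double sum as well. *)
rewrite pair_big_dep/=.
have {}pt (t : R) : D t ->
    ((\sum_(S in G) w1 S * (t < e1 S)%R%:R)%:E <=
     (\sum_(S in G) w2 S * (t < e2 S)%R%:R)%:E +
     (\sum_(q : {set 'I_(njobs I)} * 'I_(njobs I) | (q.1 \in G) && (q.2 \in q.1))
       b q.1 q.2 * (y t q.2 ord0 * (t < c q.2)%R%:R))%:E)%E.
  by move=> /DP /pt; rewrite -EFinD lee_fin pair_big_dep.
have ws0 (w e : {set 'I_(njobs I)} -> R) (t : R) :
    (forall S, S \in G -> 0 <= w S) -> 0 <= \sum_(S in G) w S * (t < e S)%R%:R :> R.
  by move=> w0; apply: sumr_ge0 => S SG; rewrite mulr_ge0// w0.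
have mws (w e : {set 'I_(njobs I)} -> R) :
    measurable_fun D (fun t : R => \sum_(S in G) w S * (t < e S)%R%:R).
  rewrite (_ : (fun t => _) = fun t : R =>
    \sum_S if S \in G then w S * (t < e S)%R%:R else 0); last first.
    by apply/funext => t; exact: big_mkcond.
  apply: measurable_sum => S; case: (S \in G); last exact: measurable_cst.
  by apply: measurable_funM => //; exact: measurable_cst.
have bs0 (t : R) : D t -> 0 <=
    \sum_(q : {set 'I_(njobs I)} * 'I_(njobs I) | (q.1 \in G) && (q.2 \in q.1))
       b q.1 q.2 * (y t q.2 ord0 * (t < c q.2)%R%:R).
  by move=> /DP t0; apply: sumr_ge0 => q /andP[qG _]; rewrite mulr_ge0 ?b0// yl0.
have mbs : measurable_fun D (fun t : R =>
    \sum_(q : {set 'I_(njobs I)} * 'I_(njobs I) | (q.1 \in G) && (q.2 \in q.1))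
       b q.1 q.2 * (y t q.2 ord0 * (t < c q.2)%R%:R)).
  rewrite (_ : (fun t => _) = fun t : R =>
    \sum_q if (q.1 \in G) && (q.2 \in q.1)
      then b q.1 q.2 * (y t q.2 ord0 * (t < c q.2)%R%:R) else 0); last first.
    by apply/funext => t; exact: big_mkcond.
  apply: measurable_sum => q; case: ((q.1 \in G) && (q.2 \in q.1)); last exact: measurable_cst.
  by apply: measurable_funM => //; exact: measurable_cst.
have Ew (w e : {set 'I_(njobs I)} -> R) : (forall S, S \in G -> 0 <= w S) ->
    (forall S, S \in G -> 0 <= e S) ->
    (\int[lebesgue_measure]_(t in D) (\sum_(S in G) w S * (t < e S)%R%:R)%R%:E =
     (\sum_(S in G) w S * e S)%R%:E)%E.
  move=> w0 e0; rewrite (ge0_integral_sumZ _ (mem G) w (fun S t => (t < e S)%R%:R))//.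
  rewrite -sumEFin; apply: eq_bigr => S SG.
  by rewrite integral_lt ?e0// EFinM.
have Eb : (\int[lebesgue_measure]_(t in D)
    (\sum_(q : {set 'I_(njobs I)} * 'I_(njobs I) | (q.1 \in G) && (q.2 \in q.1))
       b q.1 q.2 * (y t q.2 ord0 * (t < c q.2)%R%:R))%R%:E =
    (\sum_(q : {set 'I_(njobs I)} * 'I_(njobs I) | (q.1 \in G) && (q.2 \in q.1))
      b q.1 q.2 * fine (processed y q.2 (c q.2)))%R%:E)%E.
  rewrite (ge0_integral_sumZ _ (fun q => (q.1 \in G) && (q.2 \in q.1))
    (fun q => b q.1 q.2) (fun q t => y t q.2 ord0 * (t < c q.2)%R%:R))//.
    rewrite -sumEFin; apply: eq_bigr => q _.
    by rewrite integral_rate_before// EFinM fineK// processed_fin.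
  - by move=> q /andP[qG _]; exact: b0.
  - by move=> q t; exact: yl0.
rewrite -lee_fin EFinD -Eb -!Ew//.
apply: (@le_trans _ _ (\int[lebesgue_measure]_(t in D)
  ((\sum_(S in G) w2 S * (t < e2 S)%R%:R)%R%:E +
   (\sum_(q : {set 'I_(njobs I)} * 'I_(njobs I) | (q.1 \in G) && (q.2 \in q.1))
       b q.1 q.2 * (y t q.2 ord0 * (t < c q.2)%R%:R))%R%:E))%E).
  apply: ge0_le_integral => //.
  - exact: measurable_itv.
  - by move=> t _; rewrite lee_fin ws0.
  - by apply/measurable_EFinP; exact: mws.
  - by apply: emeasurable_funD; apply/measurable_EFinP; [exact: mws|exact: mbs].
rewrite ge0_integralD//.
- exact: measurable_itv.
- by move=> t _; rewrite lee_fin ws0.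
- by apply/measurable_EFinP; exact: mws.
- by apply/measurable_EFinP; exact: mbs.
Qed.

Lemma ln_nat_mono (m n : nat) : (m <= n)%N -> ln (m%:R) <= ln (n%:R) :> R.
Proof.
case: m => [_|m mn]; last by rewrite ler_ln ?posrE ?ltr0n ?ler_nat//; exact: leq_trans mn.
rewrite ln0//; case: n => [|n]; first by rewrite ln0.
by rewrite ln_ge0// ler1n.
Qed.

(** Weights are positive and all terms nonnegative, so one unfinished group already makes the cost
    infinite. *)
Lemma group_completion_fin p z S : cost p z != +oo%E ->
  S \in groups I -> group_completion p z S \is a fin_num.
Proof.
move=> cz SI; rewrite ge0_fin_numE ?group_completion_ge0// ltNge leye_eq.
apply: contra cz => /eqP Sy; rewrite -leye_eq /cost (bigD1 S)//= Sy.
rewrite gt0_muley ?lte_fin ?weight_gt0// addye//.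
rewrite -ltNye; apply: (@lt_le_trans _ _ 0%E) => //; apply: sume_ge0 => S' /andP[S'I _].
by rewrite mule_ge0 ?group_completion_ge0// lee_fin ltW// weight_gt0.
Qed.

Lemma fair_run_cost p y z : (forall j, 0 <= p j) ->
  (forall t : R, 0 <= t -> y t = fair_rates (alive p y t)) -> feasible z ->
  (cost p y <= (16 * (1 + ln ((max_group_size I)%:R)))%:E * cost p z)%E.
Proof.
move=> p0 yr zF.
have [delta d0 rP] := svalP (cid fair_rates_exists).
rewrite -/fair_rates in rP.
have rF U : polytope R (bmat I) (fair_rates U) by case: (rP U).
have yF : feasible y := run_feasible _ _ p _ rF _ yr.
set L : R := 1 + ln _.
have L1 : 1 <= L.
  by rewrite lerDl; have := @ln_nat_mono 0 (max_group_size I) isT; rewrite ln0.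
have [->|cz] := eqVneq (cost p z) +oo%E.
  by rewrite gt0_muley ?leey// lte_fin; lra.
pose c j := fine (job_completion p y j).
have cE j : job_completion p y j = (c j)%:E.
  rewrite fineK// ge0_fin_numE ?job_completion_ge0//.
  apply: le_lt_trans (ltry (p j / delta)).
  apply: job_completion_bound => // t t0; rewrite yr//.
  by have [_ + _] := rP (alive p y t); exact.
have c0 j : 0 <= c j by rewrite -lee_fin -cE job_completion_ge0.
pose C S := fine (group_completion p y S).
have CE S : group_completion p y S = (C S)%:E.
  rewrite fineK// ge0_fin_numE ?group_completion_ge0//.
  apply: le_lt_trans (ltry (\sum_j c j)); apply: bigmax_le.
    by rewrite lee_fin sumr_ge0.
  move=> j _; rewrite cE lee_fin (bigD1 j)//= lerDl.
  exact: sumr_ge0.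
have C0 S : 0 <= C S by rewrite -lee_fin -CE group_completion_ge0.
have cC S j : j \in S -> c j <= C S.
  by move=> jS; rewrite -lee_fin -CE -cE; exact: (le_bigmax_cond _ (job_completion p y)).
pose C' S := fine (group_completion p z S).
have CE' S : S \in groups I -> group_completion p z S = (C' S)%:E.
  by move=> SI; rewrite fineK// group_completion_fin.
have C'0 S : S \in groups I -> 0 <= C' S.
  by move=> SI; rewrite -lee_fin -CE'// group_completion_ge0.
have pC' S j (T : R) : S \in groups I -> j \in S -> C' S <= T ->
    ((p j)%:E <= processed z j T)%E.
  move=> SI jS CT; rewrite -job_completion_leE ?(le_trans (C'0 S SI) CT)//.
  apply: (@le_trans _ _ (C' S)%:E); last by rewrite lee_fin.
  by rewrite -CE'//; exact: (le_bigmax_cond _ (job_completion p z)).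
(* Chosen so that 2 L / kappa = 1/2, the fraction of the cost of [y] that the charges may reach. *)
pose kappa := 4 * L; have k0 : 0 < kappa by rewrite /kappa; lra.
pose k S j : R := #|[set i in S | c j <= c i]%SET|%:R.
have k_gt0 S j : j \in S -> 0 < k S j.
  by move=> jS; rewrite ltr0n; apply/card_gt0P; exists j; rewrite inE jS lexx.
(* The coefficient of the rate of j in the charge to S, made independent of t by bounding t / #|S
   :&: U| by C_S / k_j. *)
pose b S j := 2 / kappa * (weight I S * (C S / k S j / p j)).
have b0 S j : S \in groups I -> 0 <= b S j.
  move=> SI; rewrite mulr_ge0 ?divr_ge0 ?(ltW k0)// mulr_ge0//.
    by rewrite ltW// weight_gt0.
  by rewrite !divr_ge0.
have costE v (f : {set 'I_(njobs I)} -> R) :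
    (forall S, S \in groups I -> group_completion p v S = (f S)%:E) ->
    cost p v = (\sum_(S in groups I) weight I S * f S)%:E.
  by move=> fE; rewrite -sumEFin; apply: eq_bigr => S SI; rewrite fE// EFinM.
rewrite (costE y C)// (costE z C')// -EFinM lee_fin.
have := @weighted_completion_le y (weight I) (fun S => 2 * weight I S) C
  (fun S => kappa * C' S) c b (groups I) yF.
have w0 S : S \in groups I -> 0 <= weight I S by move=> SI; rewrite ltW// weight_gt0.
move=> /(_ w0); have w20 S : S \in groups I -> 0 <= 2 * weight I S.
  by move=> SI; rewrite mulr_ge0// w0.
move=> /(_ w20 (fun S _ => C0 S)); have kC0 S : S \in groups I -> 0 <= kappa * C' S.
  by move=> SI; rewrite mulr_ge0 ?C'0// ltW.
move=> /(_ kC0 c0 b0) bound.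
have aliveE j (t : R) : (j \in alive p y t) = (t < c j) by rewrite inE cE lte_fin.
have {}bound : \sum_(S in groups I) weight I S * C S <=
    \sum_(S in groups I) 2 * weight I S * (kappa * C' S) +
    \sum_(S in groups I) \sum_(j in S) b S j * fine (processed y j (c j)).
  apply: bound => t t0.
  (* No average rate exists over an interval of length 0. At t = 0, a group finished by [z] has only
     zero requirements, so [y] has finished it too. *)
  have [t00|tn0] := eqVneq t 0.
    rewrite -[leLHS]addr0; apply: lerD; last first.
      apply: sumr_ge0 => S SI; apply: sumr_ge0 => j jS.
      by rewrite mulr_ge0 ?b0// mulr_ge0// feasible_ge0.
    apply: ler_sum => S SI.
    have [C'S|C'S] := ltP t (kappa * C' S).
      by case: ltP => _; rewrite /= ?mulr1 ?mulr0 ?w20//; have := w0 S SI; lra.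
    have -> : (t < C S) = false.
      apply/negbTE; rewrite -leNgt -lee_fin -CE; apply: bigmax_le => [|j jS].
        by rewrite lee_fin.
      rewrite job_completion_leE// t00 processed0 -(processed0 _ _ z j).
      apply: (pC' S) => //; move: C'S; rewrite t00 pmulr_rle0//.
    by rewrite !mulr0.
  have {tn0}t_gt0 : 0 < t by rewrite lt_neqAle eq_sym tn0.
  pose T := t / kappa; have T0 : 0 < T by rewrite divr_gt0.
  have [x xP xE] := average_rate _ _ z T zF T0.
  have [_ ry rfair] := rP (alive p y t).
  have := @alive_weight_le R I p (alive p y t) (fun S => kappa * C' S <= t)
    (y t) x T T0.
  rewrite !yr// => /(_ _ _ (rfair x xP)).
  have U0 j : j \in alive p y t -> 0 < p j.
    rewrite inE job_completion_ltE// -lte_fin; apply: le_lt_trans.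
    exact: processed_ge0.
  move=> /(_ U0 (fun j => lt_le_trans d0 (ry j))).
  have dx S : S \in groups I -> kappa * C' S <= t -> forall j, j \in S -> p j <= T * x j ord0.
    move=> SI CT j jS; rewrite -lee_fin xE; apply: (pC' S) => //.
    by rewrite /T ler_pdivlMr// mulrC.
  move=> /(_ dx (proj1 xP)) main; rewrite -!yr// in main *.
  apply: le_trans (le_trans _ main) _.
    rewrite [leRHS]big_mkcondr/=; apply: ler_sum => S SI.
    case: ltP => tC; last by rewrite mulr0; case: ifP => // _; exact: w0.
    rewrite ifT ?mulr1//; apply/set0Pn.
    have : ~~ [forall j in S, c j <= t].
      apply/negP => /forall_inP cS; move: tC; apply/negP; rewrite -leNgt -lee_fin -CE.
      by apply: bigmax_le => [|j jS]; rewrite ?lee_fin// cE lee_fin cS.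
    move=> /forall_inPn[j jS]; rewrite -ltNge => tj.
    by exists j; rewrite inE jS aliveE.
  apply: lerD.
    rewrite mulr_sumr [leLHS]big_mkcondr/=; apply: ler_sum => S SI.
    by rewrite -ltNge; case: ltP => _ /=; rewrite ?mulr1 ?mulr0.
  rewrite mulr_sumr; apply: ler_sum => S SI.
  rewrite mulr_sumr [leLHS]big_mkcond [leRHS]big_mkcond/=; apply: ler_sum => j _.
  rewrite inE aliveE; have [jS|//] := boolP (j \in S).
  have [tc|_] /= := ltP t (c j); last by rewrite !mulr0.
  rewrite mulr1.
  set n : R := #|_|%:R.
  (* While j is unfinished, so are all jobs of S that complete no earlier than j. *)
  have kn : k S j <= n.
    rewrite ler_nat subset_leq_card//; apply/fintype.subsetP => i.
    by rewrite !inE cE lte_fin => /andP[-> /(lt_le_trans tc)].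
  have n0 : 0 < n := lt_le_trans (k_gt0 S j jS) kn.
  have tn : t / n <= C S / k S j.
    apply: ler_pM => //; rewrite ?invr_ge0 ?(ltW n0)//.
      by apply: ltW; apply: lt_le_trans tc (cC S j jS).
    by rewrite lef_pV2 ?posrE// k_gt0.
  have -> : 2 * T * (weight I S / n * (y t j ord0 / p j)) =
      2 / kappa * weight I S * (y t j ord0 / p j) * (t / n) by rewrite /T; ring.
  have -> : b S j * y t j ord0 =
      2 / kappa * weight I S * (y t j ord0 / p j) * (C S / k S j) by rewrite /b; ring.
  apply: ler_wpM2l => //.
  by rewrite !mulr_ge0 ?invr_ge0 ?(ltW k0) ?w0 ?feasible_ge0.
(* The work done on j by its completion is at most p_j, which cancels the factor 1 / p_j in [b] and
   leaves the harmonic sum. *)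
have cross : \sum_(S in groups I) \sum_(j in S) b S j * fine (processed y j (c j)) <=
    2^-1 * \sum_(S in groups I) weight I S * C S.
  rewrite mulr_sumr; apply: ler_sum => S SI.
  apply: (@le_trans _ _ (2 / kappa * (weight I S * C S) * \sum_(j in S) (k S j)^-1)).
    rewrite mulr_sumr; apply: ler_sum => j jS.
    have Pp : fine (processed y j (c j)) <= p j.
      rewrite -lee_fin fineK ?processed_fin//.
      by apply: processed_completion_le => //; exact: cE.
    apply: le_trans (ler_wpM2l (b0 S j SI) Pp) _.
    (* For p_j = 0 nothing cancels, but the left side is then 0. *)
    have [pj0|pj] := eqVneq (p j) 0.
      rewrite pj0 mulr0 !mulr_ge0 ?invr_ge0 ?(ltW k0) ?w0//.
    by rewrite /b le_eqVlt; apply/orP; left; apply/eqP; field; rewrite pj !gt_eqF ?k_gt0.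
  have kL : \sum_(j in S) (k S j)^-1 <= L.
    apply: le_trans (sum_inv_rank_le R _ c S) _; rewrite lerD2l ln_nat_mono//.
    exact: (@leq_bigmax_cond _ _ (fun S : {set 'I_(njobs I)} => #|S|)).
  apply: le_trans (ler_wpM2l _ kL) _.
    by rewrite !mulr_ge0 ?invr_ge0 ?(ltW k0) ?w0.
  rewrite le_eqVlt; apply/orP; left; apply/eqP; rewrite /kappa; field.
  by rewrite gt_eqF//; lra.
(* Here 2 kappa = 8 L; absorbing half of the cost of [y] on the left doubles this to 16 L. *)
have E : \sum_(S in groups I) 2 * weight I S * (kappa * C' S) =
    8 * L * \sum_(S in groups I) weight I S * C' S.
  by rewrite mulr_sumr; apply: eq_bigr => S _; rewrite /kappa; ring.
rewrite E in bound.
move: bound cross; move: (\sum_(S in _) _) (\sum_(S in _) _) (\sum_(S in _) _) => u v q.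
lra.
Qed.

End FairRun.

(** * The algorithm and its competitive ratio *)

Definition fair_algorithm (R : realType) : algorithm R :=
  fun I _ obs => fair_rates R I [set j | obs j == None]%SET.

Lemma fair_runP (R : realType) (I : pspg R) (p : 'I_(njobs I) -> R) y :
  is_run (@fair_algorithm R) p y <->
  (forall t : R, 0 <= t -> y t = fair_rates R I (alive p y t)).
Proof.
have E (t : R) : [set j | observed p y t j == None]%SET = alive p y t.
  by apply/setP => j; rewrite !inE ltNge /observed; case: ifP.
by split=> yr t t0; have := yr t t0; rewrite /fair_algorithm E.
Qed.

Theorem theorem1 (R : realType) :
  exists (A : algorithm R) (alpha : nat -> R),
    alpha =O_\oo (fun g => ln g%:R : R) /\
    competitive A (fun I => alpha (max_group_size I)).
Proof.
exists (@fair_algorithm R), (fun g => 16 * (1 + ln g%:R)); split.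
  (* For g >= 2, ln g >= 1/2 gives 1 <= 2 ln g, hence 16 (1 + ln g) <= 48 ln g. *)
  apply/eqO_exP; exists 48 => //; near=> g.
  have g2 : (2 <= g)%N by near: g; exact: nbhs_infty_ge.
  have ln2 : 2^-1 <= ln 2 :> R.
    have := @le_ln1Dx R (- 2^-1); rewrite (_ : 1 - 2^-1 = 2^-1 :> R); last by field.
    by rewrite lnV ?posrE// lerN2; apply; lra.
  have lng : ln 2 <= ln g%:R :> R by exact: ln_nat_mono.
  by rewrite !ger0_norm; lra.
move=> I p p0; have rF U : polytope R (bmat I) (fair_rates R I U).
  rewrite /fair_rates; case: cid => r /= [delta _ rP].
  by case: (rP U).
split.
  have [y yr] := run_exists _ _ p _ rF.
  by exists y; apply/fair_runP.
move=> y /fair_runP yr; split; first exact: run_feasible yr.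
(* A positive ratio can be divided out, so the infimum [opt] is tested against one schedule [z] at a
   time. *)
have a0 : 0 < 16 * (1 + ln ((max_group_size I)%:R)) :> R.
  by have := @ln_nat_mono R 0 (max_group_size I) isT; rewrite ln0//; lra.
rewrite -lee_pdivrMl//; apply: le_ereal_inf_tmp => _ [z zF <-].
by rewrite lee_pdivrMl//; exact: fair_run_cost.
Unshelve. all: by end_near.
Qed.
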